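(* Let $a,c,p_m,e_m,e_0,f,k,\varepsilon,\mu,\beta_H,\beta_L$ be real parameters with $f,k,e_m,e_0>0$, $0<\varepsilon<1$, $0<\mu<1$, $\beta_H>\beta_L>0$, and let $w_H^{(4)},w_L^{(4)},w_H^{(5)},w_L^{(5)}$ be the buy-back prices defined in the context (with $\Delta\neq 0$). (i) If $4\beta_L-c^2-\beta_L^2>0$ and $4\beta_L-c^2-\beta_L^2>c^2\mu$, then $w_H^{(5)}>w_H^{(4)}$. (ii) If $2-\varepsilon^2-2\mu^2>0$ and $4\beta_L-c^2-\beta_L^2+\beta_L\mu>0$, then $w_L^{(5)}>w_L^{(4)}$.
   Context: A manufacturer buys back waste products from retailer one, who has a private type: high ($H$, recycling difficulty coefficient $\beta_H$) or low ($L$, coefficient $\beta_L$, having probability $\mu$). Parameters: $a$ potential market demand, $\varepsilon$ substitute coefficient, $c$ a unit cost of retailer one, $p_m$ the manufacturer's price to retailers, $f$ the unit degree of reward/penalty for carbon emission, $e_m$ the manufacturer's unit carbon emission, $e_0$ the carbon emission upper limit, $k$ the unit degree of reward/penalty for recycling. Model IV is decentralized with competing retailers and the carbon emission constraint; Model V additionally has the government's reward-penalty mechanism for recycling. The buy-back prices of the two models for the two types are the following expressions. Put $$\Delta=2\beta_H\left(4\beta_L-c^2-\beta_L^2+\beta_L\mu\right)-2\beta_L\mu\left(c^2-\beta_H^2\right).$$ Model IV: $$w_H^{(4)}=\frac{\beta_L\left(2a+2c-2p_m+a\varepsilon-c\varepsilon p_m-c\varepsilon^2p_m+\varepsilon^2p_m-ac\varepsilon-2ac+fe_m\right)-fe_0}{\Delta},$$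 $$w_L^{(4)}=\frac{\beta_H\left(2a\beta_L-c\varepsilon p_m+\varepsilon\beta_Lp_m-c\varepsilon^2p_m+\varepsilon^2\beta_Lp_m-ac\varepsilon+a\varepsilon\beta_L-2ac\right)+\beta_L\left(2cp_m-2\beta_Lp_m+fe_m\right)-fe_0}{\Delta}.$$ Model V: $$w_H^{(5)}=\frac{\beta_L\left(2a+2c-2p_m+a\varepsilon-c\varepsilon p_m-c\varepsilon^2p_m+\varepsilon^2p_m-ac\varepsilon-2ac+fe_m\right)-fe_0}{\Delta}+\frac{k\left(2+\varepsilon^2-\mu^2\right)}{2\beta_H\left(4\beta_L-c^2-\beta_L^2\right)-2c^2\beta_L\mu},$$ $$w_L^{(5)}=\frac{\beta_H\left(2a\beta_L-c\varepsilon p_m+\varepsilon\beta_Lp_m-c\varepsilon^2p_m+\varepsilon^2\beta_Lp_m-ac\varepsilon-2ac+a\varepsilon\beta_L\right)+\beta_L\left(2cp_m-2\beta_Lp_m+fe_m\right)-fe_0}{\Delta}+\frac{k\left(2-\varepsilon^2-2\mu^2\right)}{2\beta_H\left(4\beta_L-c^2-\beta_L^2+\beta_L\mu\right)}.$$ *)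

(* Defs.v *)
(** Stdlib reals.  Buy-back prices offered to retailer one of private type
    H or L, without (suffix 4) and with (suffix 5) the recycling
    reward-penalty mechanism.  The parameters are
    - [a]        potential market demand,
    - [c]        unit cost of retailer one,
    - [pm]       manufacturer's price to the retailers,
    - [em]       manufacturer's unit carbon emission,
    - [e0]       upper limit of carbon emission,
    - [f]        unit reward/penalty for carbon emission,
    - [k]        unit reward/penalty for recycling,
    - [eps]      substitute coefficient,
    - [mu]       probability of type L,
    - [bH], [bL] recycling difficulty coefficients of the types H and L. *)
From Stdlib Require Import Reals.
Open Scope R_scope.

Definition DeltaW (c mu bH bL : R) : R :=
  2 * bH * (4 * bL - c ^ 2 - bL ^ 2 + bL * mu)
  - 2 * bL * mu * (c ^ 2 - bH ^ 2).

Definition wH4 (a c pm em e0 f eps mu bH bL : R) : R :=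
  (bL * (2 * a + 2 * c - 2 * pm + a * eps - c * eps * pm - c * eps ^ 2 * pm
         + eps ^ 2 * pm - a * c * eps - 2 * a * c + f * em)
   - f * e0) / DeltaW c mu bH bL.

Definition wL4 (a c pm em e0 f eps mu bH bL : R) : R :=
  (bH * (2 * a * bL - c * eps * pm + eps * bL * pm - c * eps ^ 2 * pm
         + eps ^ 2 * bL * pm - a * c * eps + a * eps * bL - 2 * a * c)
   + bL * (2 * c * pm - 2 * bL * pm + f * em)
   - f * e0) / DeltaW c mu bH bL.

Definition wH5 (a c pm em e0 f k eps mu bH bL : R) : R :=
  (bL * (2 * a + 2 * c - 2 * pm + a * eps - c * eps * pm - c * eps ^ 2 * pm
         + eps ^ 2 * pm - a * c * eps - 2 * a * c + f * em)
   - f * e0) / DeltaW c mu bH bL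
  + k * (2 + eps ^ 2 - mu ^ 2)
    / (2 * bH * (4 * bL - c ^ 2 - bL ^ 2) - 2 * c ^ 2 * bL * mu).

Definition wL5 (a c pm em e0 f k eps mu bH bL : R) : R :=
  (bH * (2 * a * bL - c * eps * pm + eps * bL * pm - c * eps ^ 2 * pm
         + eps ^ 2 * bL * pm - a * c * eps - 2 * a * c + a * eps * bL)
   + bL * (2 * c * pm - 2 * bL * pm + f * em)
   - f * e0) / DeltaW c mu bH bL
  + k * (2 - eps ^ 2 - 2 * mu ^ 2)
    / (2 * bH * (4 * bL - c ^ 2 - bL ^ 2 + bL * mu)).

(* Main.v *)
Require Import Defs.
From Stdlib Require Import Reals Lra.
Open Scope R_scope.

(** For each type the prices with and without the recycling mechanism share
    the same fraction over [DeltaW], so the mechanism adds exactly one term,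
    [k] times a factor depending on [eps] and [mu], over a denominator of its
    own. Both claims therefore reduce to the sign of that term. For type L the
    hypotheses give the signs of the factor and of the denominator directly.
    For type H the factor is positive because [mu ^ 2 < 1], and the
    denominator is positive by [recycling_denominator_H_pos]. *)

(** Write [X] for [4 * bL - c ^ 2 - bL ^ 2]. Since [X > 0], replacing [bH] by
    the smaller [bL] lowers [bH * X], and [bL * X] already exceeds
    [bL * (c ^ 2 * mu)]. *)
Lemma recycling_denominator_H_pos (c mu bH bL : R) :
  bH > bL -> bL > 0 ->
  4 * bL - c ^ 2 - bL ^ 2 > 0 ->
  4 * bL - c ^ 2 - bL ^ 2 > c ^ 2 * mu ->
  2 * bH * (4 * bL - c ^ 2 - bL ^ 2) - 2 * c ^ 2 * bL * mu > 0.
Proof.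
  intros hbH hbL hX hXmu.
  set (X := 4 * bL - c ^ 2 - bL ^ 2) in *.
  assert (hmono : bL * X < bH * X) by (apply Rmult_lt_compat_r; lra).
  assert (hscale : bL * (c ^ 2 * mu) < bL * X)
    by (apply Rmult_lt_compat_l; lra).
  lra.
Qed.

Theorem proposition6 (a c pm em e0 f k eps mu bH bL : R)
  (hf : f > 0) (hk : k > 0) (hem : em > 0) (he0 : e0 > 0)
  (heps : 0 < eps < 1) (hmu : 0 < mu < 1)
  (hbH : bH > bL) (hbL : bL > 0)
  (hDelta : DeltaW c mu bH bL <> 0) :
  (4 * bL - c ^ 2 - bL ^ 2 > 0 ->
   4 * bL - c ^ 2 - bL ^ 2 > c ^ 2 * mu ->
   wH5 a c pm em e0 f k eps mu bH bL > wH4 a c pm em e0 f eps mu bH bL)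
  /\
  (2 - eps ^ 2 - 2 * mu ^ 2 > 0 ->
   4 * bL - c ^ 2 - bL ^ 2 + bL * mu > 0 ->
   wL5 a c pm em e0 f k eps mu bH bL > wL4 a c pm em e0 f eps mu bH bL).
Proof.
  split.
  - intros hX hXmu.
    assert (hden := recycling_denominator_H_pos c mu bH bL hbH hbL hX hXmu).
    assert (hfactor : 0 < 2 + eps ^ 2 - mu ^ 2) by nra.
    assert (hterm := Rdiv_pos_pos _ _ (Rmult_lt_0_compat _ _ hk hfactor) hden).
    unfold wH5, wH4.
    lra.
  - intros hfactor hY.
    assert (hden : 0 < 2 * bH * (4 * bL - c ^ 2 - bL ^ 2 + bL * mu))
      by (apply Rmult_lt_0_compat; lra).
    assert (hterm := Rdiv_pos_pos _ _ (Rmult_lt_0_compat _ _ hk hfactor) hden).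
    unfold wL5, wL4.
    lra.
Qed.
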